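(* Let $n\in\mathbb{N}$. Then there is a bijection between the set of partition sequences $A_n$ and the set $\mathscr{P}(\{1,\dots,n\})$ of all partitions of $\{1,\dots,n\}$.
   Context: $\mathbb{N}$ is the set of positive integers. $A_n$ is the collection of all sequences $(a_k)_{k=1,\dots,n}$ of positive integers of length $n$ such that $a_1=1$ and, for every $k\in\{2,\dots,n\}$, $a_k\in\{1,\dots,1+\max_{l=1,\dots,k-1}a_l\}$. A partition of a set is a collection of pairwise disjoint non-empty subsets whose union is the whole set. *)

(* Defs.v *)
From mathcomp Require Import all_boot.

Set Implicit Arguments.
Unset Strict Implicit.
Unset Printing Implicit Defensive.

(* The set {1, ..., n} is represented by 'I_n, with k : 'I_n standing for k + 1;
   thus the first term of a : n.-tuple nat is nth 0 a 0. *)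
Definition partition_sequence (n : nat) (a : n.-tuple nat) : bool :=
  [&& all (fun m => 0 < m) a,
      nth 0 a 0 == 1
    & [forall k : 'I_n, (0 < k) ==>
        (1 <= tnth a k <= 1 + \max_(l < n | l < k) tnth a l)]].

Definition partition_sequences (n : nat) : Type :=
  {a : n.-tuple nat | partition_sequence a}.

Definition partitions (n : nat) : Type :=
  {P : {set {set 'I_n}} | partition P [set: 'I_n]}.

(* Main.v *)
(** A sequence [a] is sent to the partition into its level sets. By induction on
    [k], the values taken before [k] are exactly [1, ..., max], so [a k] is
    either an earlier value, determined by the level set of [k], or [1 + max];
    hence the level sets determine [a]. Conversely, the blocks of a partition
    are numbered in the order of their least elements. *)
Require Import Defs.
From mathcomp Require Import all_boot.

Set Implicit Arguments.
Unset Strict Implicit.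
Unset Printing Implicit Defensive.

(** Equality on [rT] is boolean, so [xchoose] can pick a preimage of each point; no finiteness is
    assumed, as [n.-tuple nat] is infinite in general. *)
Lemma inj_surj_bijective (aT : choiceType) (rT : eqType) (f : aT -> rT) :
  injective f -> (forall y, exists x, f x = y) -> bijective f.
Proof.
move=> f_inj f_surj.
have ex y : exists x, f x == y by have [x <-] := f_surj y; exists x.
have fK : cancel (fun y => xchoose (ex y)) f by move=> y; exact/eqP/(xchooseP (ex y)).
by exists (fun y => xchoose (ex y)) => // x; apply: f_inj; rewrite fK.
Qed.

Section PreimPartition.

Variables (T : finType) (rT1 rT2 : eqType) (f : T -> rT1) (g : T -> rT2).
Variable D : {set T}.

Lemma eq_preim_partition :
  {in D &, forall x y, (f x == f y) = (g x == g y)} ->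
  preim_partition f D = preim_partition g D.
Proof.
move=> fg; apply: eq_in_imset => x xD; apply/setP => y; rewrite !inE.
by case yD: (y \in D) => //=; rewrite fg.
Qed.

(** A block is recovered from any of its points by [pblock], so the partition remembers which points
    share a value. *)
Lemma preim_partition_eq :
  preim_partition f D = preim_partition g D ->
  {in D &, forall x y, (f x == f y) = (g x == g y)}.
Proof.
have pb (rT : eqType) (h : T -> rT) :
    {in D &, forall x y, (y \in pblock (preim_partition h D) x) = (h x == h y)}.
  apply: pblock_equivalence_partition => x y z _ _ _ /=.
  by split=> // /eqP ->.
by move=> fg x y xD yD; rewrite -(pb _ f) // fg pb.
Qed.

End PreimPartition.

Section PartitionSequence.

Variable n : nat.
Implicit Types (a b : n.-tuple nat) (k l : 'I_n).

(** For [k = 0] the maximum is empty, hence [0], and the first term [1] meets both bounds. *)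
Lemma partition_sequence_bounds a k : partition_sequence a ->
  1 <= tnth a k <= 1 + \max_(l < n | l < k) tnth a l.
Proof.
case/and3P=> _ a0 /forallP/(_ k); case: (posnP k) => [k0 _|_ //].
by rewrite (tnth_nth 0) k0 (eqP a0).
Qed.

(** Strong induction on [k]: some earlier term [l] reaches [v]. Either [v] is at most the maximum
    before [l], and induction applies, or the growth bound at [l] forces the value [v] there. *)
Lemma partition_sequence_onto a k v : partition_sequence a ->
  0 < v <= \max_(l < n | l < k) tnth a l ->
  exists2 l : 'I_n, l < k & tnth a l = v.
Proof.
move=> a_seq; have [m] := ubnP (k : nat).
elim: m k => // m IHm k le_km /andP[v_gt0 le_v].
have [l lt_lk le_vl] : exists2 l : 'I_n, l < k & v <= tnth a l.
  apply/exists_inP; apply: contraLR le_v => /exists_inPn no_l.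
  rewrite -ltnNge -(prednK v_gt0) ltnS; apply/bigmax_leqP => l lt_lk.
  by rewrite -ltnS prednK // ltnNge no_l.
have [le_v_max|lt_max_v] := leqP v (\max_(i < n | i < l) tnth a i).
  have [||i lt_il <-] := IHm l; first exact: leq_trans lt_lk _.
    by rewrite v_gt0.
  by exists i; first exact: ltn_trans lt_il lt_lk.
exists l => //; apply/eqP; rewrite eqn_leq le_vl andbT.
have /andP[_ le_l] := partition_sequence_bounds l a_seq.
exact: leq_trans le_l lt_max_v.
Qed.

Lemma partition_sequence_inj a b :
  partition_sequence a -> partition_sequence b ->
  (forall k l, (tnth a k == tnth a l) = (tnth b k == tnth b l)) -> a = b.
Proof.
move=> a_seq b_seq ab; apply: eq_from_tnth => k.
have [m] := ubnP (k : nat); elim: m k => // m IHm k le_km.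
have IHk l : l < k -> tnth a l = tnth b l.
  by move=> lt_lk; apply: IHm; exact: leq_trans lt_lk _.
have eq_max : \max_(l < n | l < k) tnth a l = \max_(l < n | l < k) tnth b l.
  exact: eq_bigr.
have /andP[a_gt0 le_a] := partition_sequence_bounds k a_seq.
have /andP[b_gt0 le_b] := partition_sequence_bounds k b_seq.
have [a_old|a_new] := leqP (tnth a k) (\max_(l < n | l < k) tnth a l).
  have [|l lt_lk al] := @partition_sequence_onto a k (tnth a k) a_seq.
    by rewrite a_gt0.
  by rewrite -al IHk //; apply/eqP; rewrite -ab al.
have [b_old|b_new] := leqP (tnth b k) (\max_(l < n | l < k) tnth b l).
  have [|l lt_lk bl] := @partition_sequence_onto b k (tnth b k) b_seq.
    by rewrite b_gt0.
  by rewrite -bl -IHk //; apply/eqP; rewrite ab bl.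
(* Both terms exceed all earlier ones, so both equal [1] plus the common maximum. *)
apply/eqP; rewrite eqn_leq (leq_trans le_a) ?(leq_trans le_b) //.
  by rewrite eq_max in a_new *.
by rewrite eq_max.
Qed.

(** The classes of [p] are ranked by their least elements: [first k] is the least element of the
    class of [k], and [a k] counts the least elements up to [first k]. *)
Lemma exists_partition_sequence (T : eqType) (p : 'I_n -> T) : 0 < n ->
  exists2 a, partition_sequence a &
    forall k l, (tnth a k == tnth a l) = (p k == p l).
Proof.
move=> n_gt0; pose first k := [arg min_(i < k | p i == p k) (i : nat)].
have p_first k : p (first k) = p k by rewrite /first; case: arg_minnP => // i /eqP.
have first_le k i : p i = p k -> first k <= i.
  by rewrite /first; case: arg_minnP => // j _ min_j /eqP; exact: min_j.
have eq_first k l : (first k == first l) = (p k == p l).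
  apply/eqP/eqP => [kl|kl]; first by rewrite -p_first kl p_first.
  by apply/val_inj/eqP; rewrite eqn_leq !first_le // p_first.
have firstK k : first (first k) = first k by apply/eqP; rewrite eq_first p_first.
pose S k := [set i | (first i == i) && (i <= first k)].
have first_in k : first k \in S k by rewrite inE firstK eqxx /=.
pose a := [tuple #|S k| | k < n].
have aE k : tnth a k = #|S k| by rewrite tnth_mktuple.
have a_gt0 k : 0 < tnth a k by rewrite aE; apply/card_gt0P; exists (first k).
exists a; last first.
  move=> k l; rewrite -eq_first !aE; apply/eqP/eqP => [|kl]; last by rewrite /S kl.
  (* The sets [S k] are nested, so equal cardinals make them equal; then [first l] lies in [S k],
     hence is at most [first k]. *)
  wlog le_kl : k l / first k <= first l => [IH eq_kl|eq_kl].
    by case/orP: (leq_total (first k) (first l)) => /IH // ->.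
  have /eqP Skl : S k == S l.
    rewrite eqEcard eq_kl leqnn andbT; apply/subsetP => i.
    by rewrite !inE => /andP[-> /leq_trans->].
  apply/val_inj/eqP; rewrite eqn_leq le_kl /=.
  by have := first_in l; rewrite -Skl inE => /andP[].
apply/and3P; split.
- by apply/allP => _ /tnthP[k ->].
- rewrite -[0]/(nat_of_ord (Ordinal n_gt0)) -tnth_nth aE.
  set k0 := Ordinal n_gt0; have fk0 : first k0 = k0.
    by apply/val_inj/eqP; rewrite -leqn0; exact: (first_le k0 k0).
  apply/cards1P; exists k0; apply/setP => i; rewrite !inE fk0 leqn0 /=.
  apply/andP/eqP => [[_ /eqP i0]|->]; [exact: val_inj | by rewrite fk0].
apply/forallP => k; apply/implyP => _; rewrite a_gt0 /=.
(* If [k] is not least in its class, its value already occurs at [first k]. *)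
have [lt_fk|] := ltnP (first k) k.
  rewrite add1n leqW //; have -> : tnth a k = tnth a (first k) by rewrite !aE /S firstK.
  exact: (@leq_bigmax_cond _ (fun l : 'I_n => l < k) (fun l => tnth a l)).
move=> le_kf; have fk : first k = k.
  by apply/val_inj/eqP; rewrite eqn_leq le_kf andbT; exact: first_le.
(* Since [k] belongs to [S k], it accounts for the [1] in the bound; the other least elements remain
   to be counted. *)
rewrite aE (cardsD1 k) -{1}fk first_in leq_add2l.
have [->|[i0 i0S]] := set_0Vmem (S k :\ k); first by rewrite cards0.
(* With [j] the last least element of a block before [k], [a k = 1 + a j]. *)
have [j jS max_j] := @arg_maxnP _ i0 (fun i => i \in S k :\ k) val i0S.
move: (jS); rewrite !inE fk => /and3P[neq_jk /eqP fj le_jk].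
have lt_jk : j < k by rewrite ltn_neqAle neq_jk.
have := @leq_bigmax_cond _ (fun l : 'I_n => l < k) (fun l => tnth a l) j lt_jk.
apply: leq_trans; rewrite aE.
(* By maximality of [j], all of [S k :\ k] lies in [S j]. *)
apply/subset_leq_card/subsetP => i iS; rewrite inE fj (max_j i iS : i <= j) andbT.
by move: iS; rewrite !inE => /and3P[].
Qed.

End PartitionSequence.

Theorem lemma2p5 (n : nat) (n_gt0 : 0 < n) :
  exists f : partition_sequences n -> partitions n, bijective f.
Proof.
pose f (a : partition_sequences n) : partitions n :=
  exist (fun P => is_true (partition P _)) _ (preim_partitionP (tnth (val a)) [set: 'I_n]).
exists f; apply: inj_surj_bijective => [a b /(congr1 val) /= ab|[P partP]].
  apply/val_inj/partition_sequence_inj; [exact: valP | exact: valP |].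
  by move=> k l; apply: (preim_partition_eq ab).
(* Surjectivity: [pblock P] sends an index to its block, so its level sets are the blocks of [P]. *)
have [a a_seq aP] := exists_partition_sequence (pblock P) n_gt0.
exists (exist (fun a => is_true (partition_sequence a)) a a_seq); apply: val_inj => /=.
by rewrite -[RHS](preim_partition_pblock partP); apply: eq_preim_partition => k l _ _.
Qed.
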